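(* Let $X$ be any strictly convex Banach space and $Y$ be a finite-dimensional polygonal Banach space. Then the pair $(X,Y)$ does not have L-P property.
   Context: All spaces are real. For a normed space $Z$, $B_Z$ is the closed unit ball, $S_Z$ the unit sphere, and $E_Z$ is the set of all extreme points of $B_Z$. A Banach space $X$ is strictly convex if $E_X=S_X$. A finite-dimensional Banach space $Y$ is called polygonal if $S_Y$ is a polytope, or equivalently, if $B_Y$ has only finitely many extreme points. $L(X,Y)$ is the Banach space of all bounded linear operators from $X$ to $Y$ with the usual operator norm. An operator $T\in L(X,Y)$ is an extreme contraction if it is an extreme point of the unit ball $B_{L(X,Y)}$. For Banach spaces $X,Y$, the pair $(X,Y)$ has L-P (Lindenstrauss–Perles) property if a norm one bounded linear operator $T\in L(X,Y)$ is an extreme contraction if and only if $T(E_X)\subseteq E_Y$.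
   Formalization: The formal theorem additionally assumes that X has dimension at least two and that Y is nonzero; for one-dimensional X, or for Y = 0, the pair (X,Y) does have L-P property, so the statement is false there. *)

(* Defs.v *)
From HB Require Import structures.
From mathcomp Require Import all_boot all_order all_algebra.
From mathcomp Require Import all_classical all_reals all_analysis.

Set Implicit Arguments.
Unset Strict Implicit.
Unset Printing Implicit Defensive.

Import Order.TTheory GRing.Theory Num.Theory.
Import numFieldNormedType.Exports.

Local Open Scope classical_set_scope.
Local Open Scope ring_scope.

Definition extreme_points (R : realType) (V : lmodType R) (A : set V) : set V :=
  [set x | A x /\ forall (y z : V) (t : R), A y -> A z -> 0 < t < 1 ->
     x = t *: y + (1 - t) *: z -> y = x /\ z = x].

Definition unit_ball (R : realType) (Z : normedModType R) : set Z :=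
  [set x | `|x| <= 1].

Definition unit_sphere (R : realType) (Z : normedModType R) : set Z :=
  [set x | `|x| = 1].

Definition strictly_convex (R : realType) (X : normedModType R) : Prop :=
  extreme_points (@unit_ball R X) = @unit_sphere R X.

Definition finite_dimensional (R : realType) (V : lmodType R) : Prop :=
  exists (n : nat) (b : 'I_n -> V),
    forall v : V, exists c : 'I_n -> R, v = \sum_(i < n) c i *: b i.

Definition polygonal (R : realType) (Y : normedModType R) : Prop :=
  finite_dimensional Y /\ finite_set (extreme_points (@unit_ball R Y)).

(* L(X, Y) is represented as a subset of the vector space X -> Y. *)
Definition bounded_operators (R : realType) (X Y : normedModType R) :
    set (X -> Y) :=
  [set T | linear T /\ bounded_fun_norm T].

(* Only meaningful on bounded_operators: sup is 0 on an unbounded set. *)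
Definition operator_norm (R : realType) (X Y : normedModType R)
    (T : X -> Y) : R :=
  sup [set `|T x| | x in @unit_ball R X].

Definition operator_unit_ball (R : realType) (X Y : normedModType R) :
    set (X -> Y) :=
  [set T | bounded_operators T /\ operator_norm T <= 1].

Definition extreme_contraction (R : realType) (X Y : normedModType R)
    (T : X -> Y) : Prop :=
  extreme_points (@operator_unit_ball R X Y) T.

Definition LP_property (R : realType) (X Y : normedModType R) : Prop :=
  forall T : X -> Y, bounded_operators T -> operator_norm T = 1 ->
    (extreme_contraction T <->
     T @` extreme_points (@unit_ball R X) `<=` extreme_points (@unit_ball R Y)).

Definition dim_at_least_two (R : realType) (V : lmodType R) : Prop :=
  exists u v : V, forall a b : R, a *: u + b *: v = 0 -> a = 0 /\ b = 0.

(* Main.v *)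
Require Import Defs.
From HB Require Import structures.
From mathcomp Require Import all_boot all_order all_algebra.
From mathcomp Require Import all_classical all_reals all_analysis.
From mathcomp Require Import lra ring.

Set Implicit Arguments.
Unset Strict Implicit.
Unset Printing Implicit Defensive.

Import Order.TTheory GRing.Theory Num.Theory.
Import numFieldNormedType.Exports.

Local Open Scope classical_set_scope.
Local Open Scope ring_scope.

(** If T = f(.) y with f an extreme point of the unit ball of X* and y a vertex
    of the polygonal ball of Y, then T is an extreme contraction: each functional
    q on Y attaining its norm at y sends a decomposition of T to a decomposition
    of q(y) f, which is trivial, and at a vertex these q separate the points of
    Y.  Since dim X >= 2, T kills a unit vector w, which is an extreme point of
    the ball of X by strict convexity, whereas T w = 0 is not extreme in Y.

    Extreme functionals come from Zorn's lemma on sublinear functions below the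
    norm, which replaces both Hahn-Banach and Krein-Milman; the same lemma
    applied to the dual of Y shows that every functional on Y attains its
    maximum over the ball at an extreme point. *)

(** * Algebra of linear functionals *)

Section ScalarFunctions.
Variables (R : realType) (V : lmodType R).
Implicit Types (f g : V -> R).

Lemma functionalD f : scalar f -> forall x y, f (x + y) = f x + f y.
Proof. by move=> lf x y; rewrite -[x]scale1r lf mul1r scale1r. Qed.

Lemma functional0 f : scalar f -> f 0 = 0.
Proof. by move=> lf; have := functionalD lf 0 0; rewrite addr0; lra. Qed.

Lemma functionalZ f : scalar f -> forall t x, f (t *: x) = t * f x.
Proof. by move=> lf t x; rewrite -[t *: x]addr0 lf functional0// addr0. Qed.

Lemma functionalN f : scalar f -> forall x, f (- x) = - f x.
Proof. by move=> lf x; rewrite -scaleN1r functionalZ// mulN1r. Qed.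

Lemma functionalB f : scalar f -> forall x y, f (x - y) = f x - f y.
Proof. by move=> lf x y; rewrite functionalD// functionalN. Qed.

Lemma functional_sum f : scalar f -> forall (I : finType) (F : I -> V),
  f (\sum_i F i) = \sum_i f (F i).
Proof.
move=> lf I F; apply: (big_morph f) => [x y|]; [exact: functionalD|exact: functional0].
Qed.

Lemma functionalDZ f g (t : R) : scalar f -> scalar g ->
  scalar (fun x => f x + t * g x).
Proof. by move=> lf lg a x y /=; rewrite lf lg; ring. Qed.

Lemma functional_le_eq f g : scalar f -> scalar g ->
  (forall x, f x <= g x) -> f =1 g.
Proof.
move=> lf lg fg x; apply/eqP; rewrite eq_le fg/=.
by have := fg (- x); rewrite !functionalN// lerN2.
Qed.

End ScalarFunctions.

(** * Sublinear functions, faces and extreme functionals *)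

Section Sublinear.
Variables (R : realType) (V : lmodType R).
Implicit Types (p N f g h : V -> R).

(** Only one inequality is asked for, at [t > 0], so that infima are easy to check; scaling back by
    [t^-1] turns it into an equality. *)
Definition sublinear p :=
  (forall x y, p (x + y) <= p x + p y) /\
  (forall t x, 0 < t -> p (t *: x) <= t * p x).

(** A function [p <= N] stands for the set of linear functionals below it, and the condition makes
    this set a face of the set of those below [N]. For linear [p] the set is a single point, so [p]
    is then extreme. *)
Definition face_below N p := forall g h t, scalar g -> scalar h ->
  (forall x, g x <= N x) -> (forall x, h x <= N x) -> 0 < t < 1 ->
  (forall x, t * g x + (1 - t) * h x <= p x) ->
  (forall x, g x <= p x) /\ (forall x, h x <= p x).

Lemma sublinear0 p : sublinear p -> p 0 = 0.
Proof.
move=> [pD pZ]; have := pD 0 0; have := pZ (1/2) 0; rewrite scaler0 addr0.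
by move=> /(_ ltac:(lra)); lra.
Qed.

Lemma sublinear_ge p x : sublinear p -> - p (- x) <= p x.
Proof. by move=> sp; have := sp.1 x (- x); rewrite subrr sublinear0//; lra. Qed.

Lemma sublinearZ p t x : sublinear p -> 0 <= t -> p (t *: x) = t * p x.
Proof.
move=> sp; rewrite le_eqVlt => /predU1P[<-|t0].
  by rewrite scale0r mul0r sublinear0.
apply/eqP; rewrite eq_le sp.2//= -ler_pdivlMl//.
have := sp.2 t^-1 (t *: x); rewrite invr_gt0 => /(_ t0).
by rewrite scalerA mulVf ?gt_eqF// scale1r.
Qed.

(** The member [s] may depend on the points: in a chain it is the smaller of [q] and [r], in the
    family defining [directional] it has a new parameter. *)
Lemma sublinear_inf (Q : set (V -> R)) : Q !=set0 ->
  (forall x, has_lbound [set q x | q in Q]) ->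
  (forall q r x y, Q q -> Q r -> exists2 s, Q s & s (x + y) <= q x + r y) ->
  (forall q t x, Q q -> 0 < t -> exists2 s, Q s & s (t *: x) <= t * q x) ->
  sublinear (fun x => inf [set q x | q in Q]).
Proof.
move=> [q0 Qq0] lbQ QD QZ.
have leinfQ x z : (forall q, Q q -> z <= q x) -> z <= inf [set q x | q in Q].
  by move=> zQ; apply: lb_le_inf => [|_ [q Qq <-]]; [exists (q0 x), q0|exact: zQ].
have infQle x q : Q q -> inf [set q x | q in Q] <= q x.
  by move=> Qq; apply: ge_inf => //; exists q.
split=> [x y|t x t0].
  rewrite /= -lerBlDr; apply: (leinfQ) => q Qq.
  rewrite lerBlDr [q x + _]addrC -lerBlDr; apply: (leinfQ) => r Qr.
  have [s Qs sle] := QD q r x y Qq Qr.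
  by rewrite lerBlDr [r y + _]addrC; exact: le_trans (infQle _ _ Qs) sle.
rewrite -ler_pdivrMl//; apply: (leinfQ) => q Qq.
rewrite ler_pdivrMl//; have [s Qs sle] := QZ q t x Qq t0.
exact: le_trans (infQle _ _ Qs) sle.
Qed.

(* For sublinear [p] the set is bounded below by [- p (- x)], so this [inf] is
   not the junk value [0]. *)
Definition directional p a x :=
  inf [set q x |
    q in [set (fun x => p (x + s *: a) - s * p a) | s in [set s : R | 0 <= s]]].

Section Directional.
Variables (p : V -> R) (sp : sublinear p) (a : V).

Lemma directional_lbound x :
  has_lbound [set q x |
    q in [set (fun x => p (x + s *: a) - s * p a) | s in [set s : R | 0 <= s]]].
Proof.
exists (- p (- x)) => _ [_ [s /= s0 <-] <-].
have := sp.1 (x + s *: a) (- x).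
by rewrite addrAC subrr add0r sublinearZ//; lra.
Qed.

Lemma directional_le x s : 0 <= s -> directional p a x <= p (x + s *: a) - s * p a.
Proof.
move=> s0; apply: ge_inf; first exact: directional_lbound.
by exists (fun x => p (x + s *: a) - s * p a) => //; exists s.
Qed.

Lemma directional_le0 x : directional p a x <= p x.
Proof.
by apply: le_trans (directional_le x (lexx 0)) _; rewrite scale0r addr0 mul0r subr0.
Qed.

Lemma directionalN : directional p a (- a) <= - p a.
Proof.
apply: le_trans (directional_le _ ler01) _.
by rewrite scale1r addNr sublinear0// mul1r sub0r.
Qed.

Lemma le_directional x z : (forall s, 0 <= s -> z <= p (x + s *: a) - s * p a) ->
  z <= directional p a x.
Proof.
move=> zp; apply: lb_le_inf => [|_ [_ [s /= s0 <-] <-]]; last exact: zp.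
by eexists; eexists; first by exists 0 => //=.
Qed.

Lemma directional_sublinear : sublinear (directional p a).
Proof.
apply: sublinear_inf.
- by eexists; exists 0 => //=.
- exact: directional_lbound.
- move=> _ _ x y [s /= s0 <-] [r /= r0 <-].
  eexists; first by exists (s + r) => //=; exact: addr_ge0.
  have := sp.1 (x + s *: a) (y + r *: a).
  by rewrite /= addrACA -scalerDl mulrDl; lra.
- move=> _ t x [s /= s0 <-] t0.
  eexists; first by exists (t * s) => //=; rewrite mulr_ge0// ltW.
  by rewrite /= -scalerA -scalerDr (sublinearZ _ sp (ltW t0)) mulrBr mulrA.
Qed.

(** At [- a] the hypothesis says that the average of [g a] and [h a] is at least [p a]. Both being
    at most [p a], they equal it, and then [g x = g (x + s *: a) - s * p a] is bounded by every
    member of the infimum; likewise for [h]. *)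
Lemma directional_face N : (forall x, p x <= N x) -> face_below N p ->
  face_below N (directional p a).
Proof.
move=> pN fp g h t lg lh gN hN /[dup] t01 /andP[t0 t1] ghp.
have [gp hp] : (forall x, g x <= p x) /\ (forall x, h x <= p x).
  apply: (fp g h t) => // x; exact: le_trans (ghp x) (directional_le0 x).
have := le_trans (ghp (- a)) directionalN; rewrite (functionalN lg) (functionalN lh) => le_pa.
have ga : g a = p a.
  apply/eqP; rewrite eq_le gp/= -(ler_pM2l t0).
  have /ler_wpM2l : 0 <= 1 - t by lra.
  by move=> /(_ _ _ (hp a)); lra.
have ha : h a = p a.
  apply/eqP; rewrite eq_le hp/= -(@ler_pM2l _ (1 - t)); last lra.
  by have /ler_wpM2l := ltW t0 => /(_ _ _ (gp a)); lra.
by split=> x; apply: le_directional => s s0;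
  [have := gp (x + s *: a)|have := hp (x + s *: a)];
  rewrite ?(functionalD lg) ?(functionalD lh) ?(functionalZ lg) ?(functionalZ lh) ?ga ?ha; lra.
Qed.

End Directional.

(* A minimal sublinear function in a face below [N] equals all its directional
   derivatives, hence is linear. *)
Lemma exists_extreme_functional N u : sublinear N ->
  exists f, [/\ scalar f, forall x, f x <= N x, f u = N u & face_below N f].
Proof.
move=> sN.
(* The condition at [- u] passes to smaller functions and, once [p] is linear, reads
   [N u <= p u]. *)
pose good p := [/\ sublinear p, forall x, p x <= N x, p (- u) <= - N u &
  face_below N p].
have goodN : good (directional N u).
  split; [exact: directional_sublinear|exact: directional_le0|
    exact: directionalN|exact: directional_face].
pose T := {p | good p}.
(* The order is reversed: a maximal element for Zorn is a minimal function. *)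
pose le_T (p q : T) := `[< forall x, sval q x <= sval p x >].
have [||||[p gp] minp] := @Zorn T le_T.
- by move=> p; apply/asboolP.
- move=> p q r /asboolP pq /asboolP qr; apply/asboolP => x.
  exact: le_trans (qr x) (pq x).
- move=> [p gp] [q gq] /asboolP/= pq /asboolP/= qp; apply: eq_exist.
  by apply/funext => x; apply/eqP; rewrite eq_le pq qp.
- move=> A totA.
  (* The empty chain is bounded separately, since its infimum would be the default value 0. *)
  have [[a0 Aa0]|A0] := pselect (A !=set0); last first.
    by exists (exist _ _ goodN) => s As; exfalso; apply: A0; exists s.
  pose Q := [set sval q | q in A].
  have lbQ x : has_lbound [set q x | q in Q].
    exists (- N (- x)) => _ [_ [[q gq] Aq <-] <-]/=.
    have [sq qN _ _] := gq; apply: le_trans _ (sublinear_ge x sq).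
    by rewrite lerN2.
  have infQ x q : A q -> inf [set q x | q in Q] <= sval q x.
    by move=> Aq; apply: ge_inf => //; exists (sval q) => //; exists q.
  have leinfQ x z : (forall q, A q -> z <= sval q x) -> z <= inf [set q x | q in Q].
    move=> zQ; apply: lb_le_inf => [|_ [_ [q Aq <-] <-]]; last exact: zQ.
    by exists (sval a0 x), (sval a0) => //; exists a0.
  suff ginf : good (fun x => inf [set q x | q in Q]).
    by exists (exist _ _ ginf) => q Aq; apply/asboolP => x /=; exact: (infQ).
  split.
  + apply: sublinear_inf => //.
    * by exists (sval a0), a0.
    * move=> _ _ x y [q Aq <-] [r Ar <-].
      have [/asboolP qr|/asboolP rq] := totA _ _ Aq Ar.
        exists (sval r); first by exists r.
        have [[rD _] _ _ _] := svalP r.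
        by apply: le_trans (rD x y) _; rewrite lerD2r.
      exists (sval q); first by exists q.
      have [[qD _] _ _ _] := svalP q.
      by apply: le_trans (qD x y) _; rewrite lerD2l.
    * move=> _ t x [q Aq <-] t0; exists (sval q); first by exists q.
      by have [[_ qZ] _ _ _] := svalP q; exact: qZ.
  + move=> x; apply: le_trans (infQ x _ Aa0) _.
    by have [_ + _ _] := svalP a0.
  + apply: le_trans (infQ _ _ Aa0) _.
    by have [_ _ + _] := svalP a0.
  + move=> g h t lg lh gN hN t01 ghp.
    by split=> x; apply: (leinfQ) => q Aq; have [_ _ _ fq] := svalP q;
      have [gq hq] := fq g h t lg lh gN hN t01
        (fun x => le_trans (ghp x) (infQ x _ Aq));
      [exact: gq|exact: hq].
have [sp pN pu fp] := gp.
have gpa a : good (directional p a).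
  split; [exact: directional_sublinear| | |exact: directional_face].
    by move=> x; exact: le_trans (directional_le0 sp _ _) (pN x).
  exact: le_trans (directional_le0 sp _ _) pu.
have pa a : directional p a = p.
  have := minp (exist _ _ (gpa a)).
  by move=> /(_ _)/(congr1 sval); apply; apply/asboolP => x /=; exact: directional_le0.
(* [directional p a] is at most [- p a] at [- a], so minimality makes [p] odd, and an odd sublinear
   function is linear. *)
have pNeg a : p (- a) = - p a.
  apply/eqP; rewrite eq_le -{1}(pa a) directionalN//=.
  by rewrite -lerN2 opprK; have := sublinear_ge a sp; lra.
have pD x y : p (x + y) = p x + p y.
  apply/eqP; rewrite eq_le sp.1/=.
  by have := sp.1 (x + y) (- y); rewrite addrK pNeg; lra.
exists p; split=> //.
- move=> t x y /=; rewrite pD; congr (_ + _).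
  have [t0|t0] := leP 0 t; first exact: sublinearZ.
  rewrite -[t]opprK scaleNr pNeg sublinearZ// ?mulNr//.
  by rewrite oppr_ge0 ltW.
- by apply/eqP; rewrite eq_le pN/= -lerN2 -pNeg.
Qed.

(** The face gives [g <= f] and [h <= f], and comparable linear functionals coincide. *)
Lemma face_below_eq N f g h t : scalar f -> scalar g -> scalar h ->
  face_below N f -> (forall x, g x <= N x) -> (forall x, h x <= N x) ->
  0 < t < 1 -> (forall x, f x = t * g x + (1 - t) * h x) -> g =1 f /\ h =1 f.
Proof.
move=> lf lg lh ff gN hN t01 fE.
have [] := ff g h t lg lh gN hN t01; first by move=> x; rewrite fE.
by move=> gf hf; split; apply: functional_le_eq.
Qed.

End Sublinear.

(** * Norming functionals and extreme points in finite dimension *)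

Section BoundedFunctionals.
Variables (R : realType) (Y : normedModType R).
Implicit Types (k g : Y -> R).

Definition bounded_functional k :=
  scalar k /\ exists C, forall y, k y <= C * `|y|.

Lemma bounded_functional_abs k : bounded_functional k ->
  exists2 C, 0 <= C & forall y, `|k y| <= C * `|y|.
Proof.
move=> [lk [C kC]]; exists `|C| => // y; have CC := ler_wpM2r (normr_ge0 y) (ler_norm C).
rewrite ler_norml lerNl -(functionalN lk) (le_trans (kC y))//.
by rewrite andbT (le_trans (kC (- y)))// normrN.
Qed.

Lemma bounded_functionalDZ k g t :
  bounded_functional k -> bounded_functional g ->
  bounded_functional (fun y => k y + t * g y).
Proof.
move=> bk bg; split; first by apply: functionalDZ; [exact: bk.1|exact: bg.1].
have [C _ kC] := bounded_functional_abs bk; have [D _ gD] := bounded_functional_abs bg.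
exists (C + `|t| * D) => y; rewrite mulrDl lerD//.
  exact: le_trans (ler_norm _) (kC y).
by rewrite -mulrA (le_trans (ler_norm _))// normrM ler_wpM2l.
Qed.

Lemma bounded_functional_sum m (t : 'I_m -> R) (k : 'I_m -> Y -> R) :
  (forall i, bounded_functional (k i)) ->
  bounded_functional (fun y => \sum_i t i * k i y).
Proof.
elim: m t k => [|m IH] t k bk.
  split; first by move=> a x y /=; rewrite !big_ord0 mulr0 addr0.
  by exists 0 => y; rewrite big_ord0 mul0r.
have := bounded_functionalDZ (t ord_max) (IH (t \o widen_ord (leqnSn m)) _
  (fun i => bk (widen_ord (leqnSn m) i))) (bk ord_max).
by under [X in _ -> bounded_functional X]funext do rewrite big_ord_recr.
Qed.

Lemma norm_sublinear : sublinear (fun y : Y => `|y|).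
Proof. by split=> [x y|t x t0]; [exact: ler_normD|rewrite normrZ gtr0_norm]. Qed.

Lemma norming_functional (w : Y) :
  exists k, [/\ scalar k, forall y, k y <= `|y| & k w = `|w|].
Proof.
have [k [lk kN kw _]] := exists_extreme_functional w norm_sublinear.
by exists k.
Qed.

Lemma contraction_bounded k : scalar k -> (forall y, k y <= `|y|) ->
  bounded_functional k.
Proof. by move=> lk kN; split=> //; exists 1 => y; rewrite mul1r. Qed.

Lemma separate_points (x y : Y) :
  (forall k, scalar k -> (forall z, k z <= `|z|) -> k x = k y) -> x = y.
Proof.
move=> kxy; have [k [lk kN kw]] := norming_functional (x - y).
apply/eqP; rewrite -subr_eq0 -normr_eq0 -kw (functionalB lk).
by rewrite (kxy k lk kN) subrr.
Qed.

(** By linearity it is enough to reproduce a spanning list, treated one vector at a time. If [P]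
    reproduces the earlier vectors and leaves a residual [w] of the new one, a norming functional
    [g] of [w] gives the new coordinate [g (z - P z)]: it is 0 on the earlier vectors and [|w|] on
    the new one. Norming functionals keep all coordinates bounded. *)
Lemma bounded_coordinates : finite_dimensional Y ->
  exists m (k : 'I_m -> Y -> R) (e : 'I_m -> Y),
    (forall i, bounded_functional (k i)) /\
    (forall y, y = \sum_i k i y *: e i).
Proof.
move=> [n [b spanb]].
suff [m [k [e [bk ke]]]] : exists m (k : 'I_m -> Y -> R) (e : 'I_m -> Y),
    (forall i, bounded_functional (k i)) /\
    {in codom b, forall y, y = \sum_i k i y *: e i}.
  exists m, k, e; split=> // y; have [c {1 2}->] := spanb y.
  under [in RHS]eq_bigr => i _.
    rewrite (functional_sum (bk i).1) scaler_suml.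
    under eq_bigr => j _ do rewrite (functionalZ (bk i).1) -scalerA.
    over.
  rewrite exchange_big/=; apply: eq_bigr => j _.
  by rewrite -scaler_sumr -ke// codom_f.
elim: (codom b) => [|y s [m [k [e [bk ke]]]]].
  by exists 0%N, (fun=> fun=> 0), (fun=> 0); split=> [[]//|y]; rewrite in_nil.
pose P z := \sum_i k i z *: e i; pose w := y - P y.
have [w0|w0] := eqVneq w 0.
  exists m, k, e; split=> // z; rewrite inE => /predU1P[->|/ke//].
  by apply/eqP; rewrite -subr_eq0; apply/eqP.
have [g [lg gN gw]] := norming_functional w.
pose h z := g z + -1 * \sum_i g (e i) * k i z.
have hE z : h z = g (z - P z).
  rewrite (functionalB lg) /P (functional_sum lg) /h mulN1r; congr (_ - _).
  by apply: eq_bigr => i _; rewrite (functionalZ lg) mulrC.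
have bh : bounded_functional h.
  by apply: bounded_functionalDZ;
    [exact: contraction_bounded|exact: bounded_functional_sum].
exists m.+1, (fun i => oapp k h (unlift ord0 i)),
  (fun i => oapp e (`|w|^-1 *: w) (unlift ord0 i)).
split=> [i|z]; first by case: unliftP => [j|] _ /=.
rewrite inE => zs; rewrite big_ord_recl unlift_none/=.
under eq_bigr => i _ do rewrite liftK/=.
rewrite -/(P z) hE; move: zs => /predU1P[->|/ke zP].
  rewrite -/w gw scalerA divff ?normr_eq0// scale1r /w.
  by rewrite subrK.
by rewrite -/(P z) in zP; rewrite -zP subrr (functional0 lg) scale0r add0r.
Qed.

(* Applied to the space of functionals (encoded as row vectors), the extreme
   functional is evaluation at an extreme point of the unit ball. *)
Lemma max_at_extreme_point k : finite_dimensional Y -> bounded_functional k ->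
  exists2 y, extreme_points (@unit_ball R Y) y &
    forall z, `|z| <= 1 -> k z <= k y.
Proof.
move=> /bounded_coordinates[m [c [e [bc ce]]]] bk.
pose ev (a : 'rV[R]_m) y := \sum_i a 0 i * c i y.
have bev a : bounded_functional (ev a) by exact: bounded_functional_sum.
have lev y : scalar (ev^~ y).
  move=> t a a' /=; rewrite /ev mulr_sumr -big_split/=; apply: eq_bigr => i _.
  by rewrite !mxE mulrDl mulrA.
pose rep (g : Y -> R) : 'rV[R]_m := \row_i g (e i).
have ev_rep g y : scalar g -> ev (rep g) y = g y.
  move=> lg; rewrite [in RHS](ce y) (functional_sum lg); apply: eq_bigr => i _.
  by rewrite mxE (functionalZ lg) mulrC.
(* The dual norm, pulled back to row vectors. *)
pose N a := sup [set ev a y | y in @unit_ball R Y].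
have le_N a y : `|y| <= 1 -> ev a y <= N a.
  move=> y1; apply: ub_le_sup; last by exists y.
  have [C C0 evC] := bounded_functional_abs (bev a).
  exists C => _ [z z1 <-]; apply: le_trans (ler_norm _) _.
  by apply: le_trans (evC z) _; rewrite ler_piMr.
have N_le a r : (forall y, `|y| <= 1 -> ev a y <= r) -> N a <= r.
  move=> evr; apply: ge_sup => [|_ [y y1 <-]]; last exact: evr.
  by exists (ev a 0), 0 => //=; rewrite /unit_ball /= normr0.
have sN : sublinear N.
  split=> [a a'|t a t0]; apply: (N_le) => y y1.
    by rewrite (functionalD (lev y)) lerD// le_N.
  by rewrite (functionalZ (lev y)) ler_pM2l// le_N.
have [f [lf fN fk ff]] := exists_extreme_functional (rep k) sN.
(* The point at which [f] is evaluation, read off from the unit rows. *)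
pose y0 := \sum_i f (delta_mx 0 i) *: e i.
have f_rep g : scalar g -> f (rep g) = g y0.
  move=> lg; rewrite [rep g]row_sum_delta (functional_sum lf) (functional_sum lg).
  by apply: eq_bigr => i _; rewrite (functionalZ lf) (functionalZ lg) mxE mulrC.
(* The [e i] may be dependent, so different rows can encode one functional; [N] is at most 0 on
   their difference, hence [f] does not distinguish them. *)
have f_le a a' : (forall y, ev a y = ev a' y) -> f a <= f a'.
  move=> aa'; rewrite -subr_le0 -(functionalB lf); apply: le_trans (fN _) _.
  by apply: (N_le) => y _; rewrite (functionalB (lev y)) aa' subrr.
have f_ev a : f a = ev a y0.
  rewrite -(f_rep _ (bev a).1); apply/eqP; rewrite eq_le.
  by apply/andP; split; apply: f_le => y; rewrite (ev_rep _ _ (bev a).1).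
exists y0; last first.
  move=> z z1; rewrite -(f_rep _ bk.1) fk -(ev_rep _ z bk.1).
  exact: le_N.
split.
  rewrite /unit_ball /=; have [g [lg gN <-]] := norming_functional y0.
  rewrite -f_rep//; apply: le_trans (fN _) _; apply: (N_le) => y y1.
  by rewrite ev_rep// (le_trans (gN y)).
move=> y z t y1 z1 t01 y0E.
(* A decomposition of [y0] decomposes [f] into the evaluations at [y] and [z], which lie below
   [N]. *)
have [evy evz] := face_below_eq lf (lev y) (lev z) ff (fun a => le_N a y y1)
  (fun a => le_N a z z1) t01
  (fun a => etrans (f_ev a) (etrans (congr1 (ev a) y0E)
    (etrans (functionalD (bev a).1 _ _)
      (congr2 +%R (functionalZ (bev a).1 _ _) (functionalZ (bev a).1 _ _))))).
by split; apply: separate_points => g lg _; rewrite -(f_rep g lg);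
  [rewrite -evy ev_rep|rewrite -evz ev_rep].
Qed.

(* A tie between two maximizers is broken by adding to [h] a small multiple of
   a functional separating them. *)
Lemma exists_vertex (s : seq Y) : s != [::] -> {in s, forall y, `|y| <= 1} ->
  exists y h d, [/\ y \in s, bounded_functional h, 0 < d &
    {in s, forall z, z != y -> h z + d <= h y}].
Proof.
case: s => [//|x s] _; elim: s x => [x _|z s IH x s1].
  have [k [lk kN _]] := norming_functional x.
  exists x, k, 1; split; rewrite ?mem_head//; first exact: contraction_bounded.
  by move=> z; rewrite inE => ->.
have [y [h [d [ys bh d0 hd]]]] := IH z (fun w ws => s1 w (@mem_behead _ [:: x, z & s] w ws)).
have sub w : w \in x :: z :: s -> w != x -> w \in z :: s.
  by rewrite inE => /predU1P[->|//]; rewrite eqxx.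
have [yx|yx] := eqVneq y x.
  exists x, h, d; split=> //; first exact: mem_head.
  by move=> w ws wx; rewrite -yx; apply: hd; [exact: sub|rewrite yx].
have [hxy|hxy|hxy] := ltgtP (h x) (h y).
- exists y, h, (Num.min d (h y - h x)); split=> //.
  + by rewrite inE ys orbT.
  + by rewrite lt_min d0 subr_gt0.
  + move=> w ws wy; have [->|wx] := eqVneq w x.
      by rewrite -lerBrDl ge_min lexx orbT.
    apply: le_trans (hd w (sub _ ws wx) wy).
    by rewrite lerD2l ge_min lexx.
- exists x, h, (h x - h y); split=> //; first exact: mem_head.
    by rewrite subr_gt0.
  move=> w ws wx; have [->|wy] := eqVneq w y; first lra.
  have := hd w (sub _ ws wx) wy; lra.
- have [k [lk kN kxy]] := norming_functional (x - y).
  have xy0 : 0 < `|x - y| by rewrite normr_gt0 subr_eq0 eq_sym.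
  (* Here [h x = h y]. On vectors of norm at most 1 the new term is at most [d / 4] in absolute
     value, so a gap [d] shrinks to [d / 2] at worst; against [y] the gap is exactly
     [d / 4 * |x - y|]. *)
  exists x, (fun w => h w + d / 4 * k w), (Num.min (d / 4 * `|x - y|) (d / 2)).
  split=> //; first exact: mem_head.
  + exact: bounded_functionalDZ (contraction_bounded lk kN).
  + by rewrite lt_min mulr_gt0 ?divr_gt0.
  + move=> w ws wx.
    have d4 : 0 <= d / 4 by lra.
    have k1 v : v \in x :: z :: s -> d / 4 * k v <= d / 4.
      move=> vs; rewrite ler_piMr//.
      exact: le_trans (kN v) (s1 v vs).
    have kx1 : - (d / 4) <= d / 4 * k x.
      rewrite lerNl -mulrN -(functionalN lk) ler_piMr//.
      by rewrite (le_trans (kN _))// normrN s1// mem_head.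
    have [->|wy] := eqVneq w y.
      rewrite (functionalB lk) in kxy.
      have := ge_min (d / 4 * `|x - y|) (d / 4 * `|x - y|) (d / 2).
      by rewrite lexx/= -{2}kxy hxy; lra.
    have := ge_min (d / 2) (d / 4 * `|x - y|) (d / 2); rewrite lexx orbT.
    have := hd w (sub _ ws wx) wy; have := k1 w ws; lra.
Qed.

End BoundedFunctionals.

(** * Vertices of the ball and rank-one contractions *)

Section RankOneContractions.
Variable R : realType.

Lemma extreme_point_norm (Y : normedModType R) (y : Y) :
  (exists w : Y, w != 0) -> extreme_points (@unit_ball R Y) y -> `|y| = 1.
Proof.
move=> [w w0] [/= y1 ey]; apply/eqP; move: y1; rewrite eq_le /unit_ball/= => y1.
rewrite y1 leNgt; apply/negP => y_lt1.
(* Of norm exactly [1 - |y|], so that [y] is the midpoint of [y + v] and [y - v] inside the ball. *)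
pose v := ((1 - `|y|) / `|w|) *: w.
have nv : `|v| = 1 - `|y|.
  rewrite normrZ ger0_norm ?divr_ge0 ?subr_ge0// divfK// normr_eq0//.
have [||||+ _] := ey (y + v) (y - v) (1 / 2).
- by rewrite /unit_ball/= (le_trans (ler_normD _ _))// nv; lra.
- by rewrite /unit_ball/= (le_trans (ler_normB _ _))// nv; lra.
- lra.
- have -> : 1 - 1 / 2 = 1 / 2 :> R by lra.
  rewrite -scalerDr addrACA subrr addr0 -[y in y + y]scale1r -scalerDl scalerA.
  have -> : 1 / 2 * (1 + 1) = 1 :> R by lra.
  by rewrite scale1r.
move/eqP; rewrite -subr_eq0 addrAC subrr add0r => /eqP v0.
by move: nv; rewrite v0 normr0; lra.
Qed.

Lemma operator_unit_ball_le (X Y : normedModType R) (U : X -> Y) (x : X) :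
  operator_unit_ball U -> `|U x| <= `|x|.
Proof.
move=> [[lU bU] U1]; have U0 : U 0 = 0.
  by have := lU (-1) 0 0; rewrite scaler0 addr0 scaleN1r addNr.
have [->|x0] := eqVneq x 0; first by rewrite U0 !normr0.
have nx : 0 < `|x| by rewrite normr_gt0.
have : `|U (`|x|^-1 *: x)| <= 1.
  apply: le_trans U1; apply: ub_le_sup.
    by have [M UM] := bU 1; exists M => _ [z z1 <-]; exact: UM.
  exists (`|x|^-1 *: x) => //=.
  by rewrite /unit_ball/= normrZ ger0_norm ?invr_ge0// mulVf ?gt_eqF.
rewrite -[_ *: x]addr0 lU U0 addr0 normrZ ger0_norm ?invr_ge0//.
by rewrite ler_pdivrMl// mulr1.
Qed.

(** The functionals maximal at a vertex contain a whole ball around [h]. If [h] favours [y] by a gap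
    [d] over the other extreme points, adding [d / 2] times a contractive [k] changes differences by
    at most [d], and the maximum over the ball is attained at an extreme point. *)
Lemma polygonal_vertex (Y : normedModType R) : polygonal Y ->
  exists (y : Y) (h : Y -> R) (d : R),
    [/\ extreme_points (@unit_ball R Y) y, scalar h, 0 < d &
      forall k, scalar k -> (forall z, k z <= `|z|) ->
        forall z, `|z| <= 1 -> h z + d * k z <= h y + d * k y].
Proof.
move=> [fdY /finite_seqP[s Es]].
have inE y : extreme_points (@unit_ball R Y) y <-> y \in s by rewrite Es.
(* Maximizing the zero functional shows that an extreme point exists. *)
have b0 : bounded_functional (fun _ : Y => 0 : R).
  by split=> [a x y|]; [rewrite /= mulr0 addr0|exists 0 => y; rewrite mul0r].
have s0 : s != [::].
  have [y /inE ys _] := max_at_extreme_point fdY b0.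
  by apply: contraTneq ys => ->; rewrite in_nil.
have s1 : {in s, forall y, `|y| <= 1} by move=> y /inE[].
have [y [h [d [ys bh d0 hd]]]] := exists_vertex s0 s1.
exists y, h, (d / 2); split; [exact/inE|exact: bh.1|by rewrite divr_gt0|].
move=> k lk kN z z1.
have [e /inE es /(_ z z1)/le_trans] := max_at_extreme_point fdY
  (bounded_functionalDZ (d / 2) bh (contraction_bounded lk kN)).
apply; have [->//|ey] := eqVneq e y.
have kdist : k (e - y) <= 2.
  apply: le_trans (kN _) _; apply: le_trans (ler_normB _ _) _.
  by have := s1 e es; have := s1 y ys; lra.
have := ler_wpM2l (ltW d0) kdist; rewrite (functionalB lk).
by have := hd e es ey; lra.
Qed.

(** For [q] maximal at [y] with [q y > 0], the functionals [q (U x) / q y] and [q (V x) / q y] lie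
    below the norm and average to [f], so both equal [f]. *)
Lemma extreme_rank_one (X Y : normedModType R) (f : X -> R) (y : Y) (h : Y -> R)
    (d : R) : scalar f ->
  face_below (fun x : X => `|x|) f -> `|y| = 1 -> scalar h -> 0 < d ->
  (forall k, scalar k -> (forall z, k z <= `|z|) ->
    forall z, `|z| <= 1 -> h z + d * k z <= h y + d * k y) ->
  operator_unit_ball (fun x => f x *: y) ->
  extreme_contraction (fun x => f x *: y).
Proof.
move=> lf ff y1 lh d0 hmax T1; split=> // U V t U1 V1 t01 TUV.
have [[lU _] _] := U1; have [[lV _] _] := V1.
have UN x := operator_unit_ball_le x U1; have VN x := operator_unit_ball_le x V1.
have comp (q : Y -> R) : scalar q -> (forall z, `|z| <= 1 -> q z <= q y) ->
    forall x, q (U x) = q y * f x /\ q (V x) = q y * f x.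
  move=> lq qmax.
  have qN z : q z <= q y * `|z|.
    have [->|z0] := eqVneq z 0; first by rewrite normr0 mulr0 (functional0 lq).
    have nz : 0 < `|z| by rewrite normr_gt0.
    have := qmax (`|z|^-1 *: z).
    rewrite normrZ ger0_norm ?invr_ge0// mulVf ?gt_eqF// => /(_ (lexx _)).
    by rewrite (functionalZ lq) ler_pdivrMl// mulrC.
  have := qN (- y); rewrite normrN y1 mulr1 (functionalN lq) => qy.
  (* Division by [q y] fails here, but a linear [q] that is nowhere positive is zero. *)
  have [q0|q0] := eqVneq (q y) 0.
    have qE : q =1 (fun=> 0).
      apply: (functional_le_eq lq) => [a u v|z]; first by rewrite /= mulr0 addr0.
      by have := qN z; rewrite q0 mul0r.
    by move=> x; rewrite !qE mul0r.
  have {qy}q0 : 0 < q y by rewrite lt_def q0; lra.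
  have lqU (W : X -> Y) : linear W -> scalar (fun x => (q y)^-1 * q (W x)).
    by move=> lW a u v /=; rewrite lW lq; ring.
  have qUN (W : X -> Y) : (forall x, `|W x| <= `|x|) ->
      forall x, (q y)^-1 * q (W x) <= `|x|.
    move=> WN x; rewrite ler_pdivrMl//; apply: le_trans (qN _) _.
    by rewrite ler_pM2l.
  have fE x : f x = t * ((q y)^-1 * q (U x)) + (1 - t) * ((q y)^-1 * q (V x)).
    apply: (mulfI (lt0r_neq0 q0)); rewrite mulrDr (mulrCA (q y) t) (mulrCA (q y) (1 - t)) !mulVKf ?gt_eqF//.
    have /(congr1 (fun F : X -> Y => q (F x)))/= := TUV.
    by rewrite !fctE (functionalD lq) !(functionalZ lq) mulrC => ->.
  have [fU fV] := face_below_eq lf (lqU U lU) (lqU V lV) ff (qUN U UN) (qUN V VN)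
    t01 fE.
  by move=> x; rewrite -{1}fU -fV !mulVKf ?gt_eqF.
(* Both [h + d * k] and [h] (the case [k = 0]) are maximal at [y]; subtracting leaves
   [k (W x) = f x * k y] for every contractive [k]. *)
have sep (W : X -> Y) : (forall q : Y -> R, scalar q ->
    (forall z, `|z| <= 1 -> q z <= q y) -> forall x, q (W x) = q y * f x) ->
    W = (fun x => f x *: y).
  move=> Wq; apply/funext => x; apply: separate_points => k lk kN.
  have := Wq _ (functionalDZ d lh lk) (hmax k lk kN) x.
  have l0 : scalar (fun _ : Y => 0 : R) by move=> a u v; rewrite /= mulr0 addr0.
  have := Wq _ (functionalDZ d lh l0) (hmax _ l0 (fun=> normr_ge0 _)) x.
  rewrite /= !mulr0 !addr0 (functionalZ lk) => -> /eqP.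
  rewrite mulrDl (inj_eq (addrI _)) -mulrA (inj_eq (mulfI (lt0r_neq0 d0))).
  by move/eqP => ->; rewrite mulrC.
by split; apply: sep => q lq qmax x; have [] := comp q lq qmax x.
Qed.

End RankOneContractions.

(** * The operator that violates the property *)

Theorem theorem2p9 (R : realType) (X Y : completeNormedModType R)
    (X_dim : dim_at_least_two X) (Y_nontrivial : exists y : Y, y != 0)
    (X_strictly_convex : strictly_convex X) (Y_polygonal : polygonal Y) :
  ~ LP_property X Y.
Proof.
move=> LP; have [u [v uv]] := X_dim.
have u0 : u != 0.
  apply/eqP => u0; have [] := uv 1 0; last by move/eqP; rewrite oner_eq0.
  by rewrite u0 scaler0 scale0r addr0.
have [y [h [d [ey lh d0 hmax]]]] := polygonal_vertex Y_polygonal.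
have y1 := extreme_point_norm Y_nontrivial ey.
have [f [lf fN fu ff]] := exists_extreme_functional u (norm_sublinear X).
have fabs x : `|f x| <= `|x|.
  by rewrite ler_norml fN lerNl -(functionalN lf) andbT (le_trans (fN _))// normrN.
pose T x := f x *: y.
have nT x : `|T x| = `|f x| by rewrite /T normrZ y1 mulr1.
have bT : bounded_operators T.
  split=> [a x z|r]; first by rewrite /T lf scalerDl scalerA.
  by exists r => x xr; rewrite nT (le_trans (fabs x)).
have T_ub : ubound [set `|T x| | x in @unit_ball R X] 1.
  by move=> _ [x x1 <-]; rewrite nT (le_trans (fabs x)).
have nT1 : operator_norm T = 1.
  apply/eqP; rewrite eq_le; apply/andP; split.
    apply: ge_sup => //; exists `|T 0|, 0 => //=.
    by rewrite /unit_ball/= normr0.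
  apply: ub_le_sup; first by exists 1.
  exists (`|u|^-1 *: u).
    by rewrite /unit_ball/= normrZ ger0_norm ?invr_ge0// mulVf ?normr_eq0.
  by rewrite nT (functionalZ lf) fu mulVf ?normr_eq0// normr1.
have eT : extreme_contraction T.
  by apply: (extreme_rank_one lf ff y1 lh d0 hmax); split=> //; rewrite nT1.
have TE := (LP T bT nT1).1 eT.
(* A kernel vector of [f], nonzero because [f u = |u|] is nonzero and [u], [v] are independent. *)
pose w := f v *: u - f u *: v.
have w0 : w != 0.
  apply/eqP; rewrite /w -scaleNr => /uv[_ /eqP].
  by rewrite oppr_eq0 fu normr_eq0 (negbTE u0).
have fw : f w = 0 by rewrite /w (functionalB lf) !(functionalZ lf) mulrC subrr.
(* The normalized [w] is extreme by strict convexity, so its image, which is 0, would have norm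
   1. *)
have /TE/(extreme_point_norm Y_nontrivial)/eqP :
    (T @` extreme_points (@unit_ball R X)) (T (`|w|^-1 *: w)).
  exists (`|w|^-1 *: w) => //; rewrite X_strictly_convex /unit_sphere/=.
  by rewrite normrZ ger0_norm ?invr_ge0// mulVf ?normr_eq0.
by rewrite nT (functionalZ lf) fw mulr0 normr0 eq_sym oner_eq0.
Qed.
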